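(* Let $H(x,\xi;s)$ be a smooth one-parameter family of Hamiltonians on $T^*M\setminus 0$, $s$ real near $0$, each positive and homogeneous of degree two in $\xi$. Let $[0,1]\ni t\mapsto\gamma(t;s)=(x(t;s),\xi(t;s))$ be Hamiltonian curves related to $H(x,\xi;s)$, smoothly dependent on the real parameter $s$. Then the energy $$E(\gamma(\,\cdot\,;s))=\int_0^1H(x(t;s),\xi(t;s);0)\,\mathrm dt$$ satisfies $$\frac{\mathrm d}{\mathrm ds}\Big|_{s=0}E(\gamma(\,\cdot\,;s))=\langle\xi(t;0),x_s(t;0)\rangle\Big|_{t=0}^{t=1}-2\int_0^1H_s(x(t;0),\xi(t;0);0)\,\mathrm dt .$$
   Context: $M$ is a smooth manifold (possibly with boundary) of dimension $n\ge2$, $T^*M\setminus0$ its cotangent bundle without the zero section. Homogeneous of degree two means $H(x,\lambda\xi;s)=\lambda^2H(x,\xi;s)$ for $\lambda>0$; each $H(\cdot,\cdot;s)$ is also assumed to satisfy $\mathrm dH\ne0$ on the level set $H=1/2$. A Hamiltonian curve related to $H(\cdot,\cdot;s)$ (for fixed $s$) is a solution $t\mapsto(x(t;s),\xi(t;s))$ of $\dot x=H_\xi$, $\dot\xi=-H_x$. $x_s=\partial x/\partial s$ is the variation of the base curve, and $H_s$ denotes the partial derivative of $H(x,\xi;s)$ in its last argument only. Note that the energy is computed with the unperturbed Hamiltonian $H(\cdot,\cdot;0)$. *)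

(* Defs.v *)
From HB Require Import structures.
From mathcomp Require Import all_boot all_order all_algebra.
From mathcomp Require Import all_classical all_reals all_analysis.

Set Implicit Arguments.
Unset Strict Implicit.
Unset Printing Implicit Defensive.

Import Order.TTheory GRing.Theory Num.Theory.
Import numFieldNormedType.Exports.

Local Open Scope classical_set_scope.
Local Open Scope ring_scope.

Fixpoint Ck (R : realType) (V W : normedModType R) (k : nat) (U : set V)
    (f : V -> W) : Prop :=
  if k is k'.+1 then
    (forall x, U x -> differentiable f x) /\
    (forall v, Ck k' U (fun x => 'D_v f x))
  else forall x, U x -> {for x, continuous f}.

(* Smoothness on a set A that need not be open (half-space pieces, closed time
   intervals): f is near each point of A the restriction to A of a C^oo map. *)
Definition smooth_on (R : realType) (V W : normedModType R) (A : set V)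
    (f : V -> W) : Prop :=
  forall x, A x -> exists U : set V, exists g : V -> W,
    [/\ open U, U x, forall k, Ck k U g & forall y, A y -> U y -> g y = f y].

(* Directional derivative of f at a along v using only the points of A on the
   line a + R v: it is one-sided when that line leaves A at a, and agrees with
   'D_v f a when A is a neighbourhood of a. *)
Definition derive_in (R : realType) (V W : normedModType R) (A : set V)
    (f : V -> W) (a v : V) : W :=
  lim ((fun h : R => h^-1 *: (f (a + h *: v) - f a)) @
       within [set h : R | A (a + h *: v)] 0^').

Definition unit_vec (R : realType) (n : nat) (i : 'I_n) : 'rV[R]_n :=
  delta_mx 0 i.

(* The constraint bears on the last coordinate only. *)
Definition half_space (R : realType) (n : nat) : set 'rV[R]_n :=
  [set y | forall i : 'I_n, i.+1 = n -> 0 <= y 0 i].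

Record manifold (R : realType) (n : nat) := Manifold {
  manifold_point :> topologicalType;
  manifold_hausdorff : hausdorff_space manifold_point;
  manifold_countable : @second_countable manifold_point;
  chart : Type;
  chart_dom : chart -> set manifold_point;
  chart_map : chart -> manifold_point -> 'rV[R]_n;
  chart_inv : chart -> 'rV[R]_n -> manifold_point;
  chart_cover : forall p, exists c, chart_dom c p;
  chart_dom_open : forall c, open (chart_dom c);
  chart_mapK : forall c p, chart_dom c p -> chart_inv c (chart_map c p) = p;
  chart_img_open : forall c, exists2 U : set 'rV[R]_n,
    open U & chart_map c @` chart_dom c = U `&` @half_space R n;
  chart_map_cont : forall c, {within chart_dom c, continuous (chart_map c)};
  chart_inv_cont : forall c,
    {within chart_map c @` chart_dom c, continuous (chart_inv c)};
  chart_transition : forall c d,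
    smooth_on (chart_map c @` (chart_dom c `&` chart_dom d))
      (fun y => chart_map d (chart_inv c y))
}.

Section Cotangent.
Context (R : realType) (n : nat) (M : manifold R n).
Implicit Types (c d : chart M) (p : M).

Definition chart_img c : set 'rV[R]_n := chart_map c @` chart_dom c.

(* Row i is the derivative of the transition map from c to d along the i-th
   coordinate of c. *)
Definition jac c d p : 'M[R]_n :=
  \matrix_(i < n)
    derive_in (chart_map c @` (chart_dom c `&` chart_dom d))
      (fun y => chart_map d (chart_inv c y)) (chart_map c p) (@unit_vec R n i).

(* A point of T^*M: a base point with the components of a covector in all
   charts around it, related by xi_i = \sum_j (dy_j / dx_i) eta_j. The
   components in the other charts are set to 0, so that equal cotangent
   vectors are Leibniz equal. *)
Record cotangent := Cotangent {
  base_pt : M;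
  covec : chart M -> 'rV[R]_n;
  covec_law : forall c d, chart_dom c base_pt -> chart_dom d base_pt ->
    covec c = covec d *m (jac c d base_pt)^T;
  covec_out : forall c, ~ chart_dom c base_pt -> covec c = 0
}.

Definition cotangent_nonzero (z : cotangent) : Prop := exists c, covec z c <> 0.

Lemma cotangent_scale_law (a : R) (z : cotangent) c d :
  chart_dom c (base_pt z) -> chart_dom d (base_pt z) ->
  a *: covec z c = (a *: covec z d) *m (jac c d (base_pt z))^T.
Proof. by move=> zc zd; rewrite -scalemxAl -covec_law. Qed.

Lemma cotangent_scale_out (a : R) (z : cotangent) c :
  ~ chart_dom c (base_pt z) -> a *: covec z c = 0.
Proof. by move=> zc; rewrite covec_out// scaler0. Qed.

Definition cotangent_scale (a : R) (z : cotangent) : cotangent :=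
  @Cotangent (base_pt z) (fun c => a *: covec z c)
    (@cotangent_scale_law a z) (@cotangent_scale_out a z).

(* The coordinate expression H(x, xi; s) in the chart c: the value of H at the
   cotangent vector whose base point and covector have coordinates x and xi
   in c, and 0 when x is not in the image of c. That cotangent vector exists
   and is unique by cotangent_exists and cotangent_eq; see also local_repE. *)
Definition local_rep (H : cotangent -> R -> R) c (x xi : 'rV[R]_n) (s : R) : R :=
  xget 0 [set r | exists2 z : cotangent,
    [/\ chart_dom c (base_pt z), chart_map c (base_pt z) = x & covec z c = xi] &
    r = H z s].

Definition H_x (H : cotangent -> R -> R) c (x xi : 'rV[R]_n) (s : R) : 'rV[R]_n :=
  \row_(i < n) derive_in (chart_img c) (fun y => local_rep H c y xi s)
                 x (@unit_vec R n i).

Definition H_xi (H : cotangent -> R -> R) c (x xi : 'rV[R]_n) (s : R) : 'rV[R]_n :=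
  \row_(i < n) 'D_(@unit_vec R n i) (fun eta => local_rep H c x eta s) xi.

(* A smooth family, for |s| < e, of Hamiltonians on the complement of the zero
   section; the values of H on the zero section are irrelevant. *)
Record hamiltonian_family (e : R) (H : cotangent -> R -> R) : Prop := {
  ham_smooth : forall c,
    smooth_on [set u : 'rV[R]_n * 'rV[R]_n * R |
                 [/\ chart_img c u.1.1, u.1.2 <> 0 & `|u.2| < e]]
      (fun u => local_rep H c u.1.1 u.1.2 u.2);
  ham_pos : forall z s, cotangent_nonzero z -> `|s| < e -> 0 < H z s;
  ham_homog : forall z s (a : R), cotangent_nonzero z -> `|s| < e -> 0 < a ->
    H (cotangent_scale a z) s = a ^+ 2 * H z s;
  ham_regular : forall z s c, cotangent_nonzero z -> `|s| < e -> H z s = 2^-1 ->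
    chart_dom c (base_pt z) ->
    ~ (H_x H c (chart_map c (base_pt z)) (covec z c) s = 0 /\
       H_xi H c (chart_map c (base_pt z)) (covec z c) s = 0)
}.

Definition curve_x (g : R -> R -> cotangent) c (t s : R) : 'rV[R]_n :=
  chart_map c (base_pt (g t s)).

Definition curve_xi (g : R -> R -> cotangent) c (t s : R) : 'rV[R]_n :=
  covec (g t s) c.

Definition curve_domain (e : R) : set (R * R) :=
  [set u | 0 <= u.1 <= 1 /\ `|u.2| < e].

Record smooth_curve_family (e : R) (g : R -> R -> cotangent) : Prop := {
  curve_nonzero : forall t s, curve_domain e (t, s) -> cotangent_nonzero (g t s);
  curve_cont : {within curve_domain e, continuous (fun u => base_pt (g u.1 u.2))};
  curve_smooth : forall c,
    smooth_on [set u | curve_domain e u /\ chart_dom c (base_pt (g u.1 u.2))]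
      (fun u => (curve_x g c u.1 u.2, curve_xi g c u.1 u.2))
}.

(* Time derivatives are one-sided at t = 0 and t = 1. *)
Definition hamiltonian_curve (H : cotangent -> R -> R) (s : R)
    (g : R -> R -> cotangent) : Prop :=
  forall t c, 0 <= t <= 1 -> chart_dom c (base_pt (g t s)) ->
    derive_in (`[0, 1] : set R) (fun t' => curve_x g c t' s) t 1 =
      H_xi H c (curve_x g c t s) (curve_xi g c t s) s /\
    derive_in (`[0, 1] : set R) (fun t' => curve_xi g c t' s) t 1 =
      - H_x H c (curve_x g c t s) (curve_xi g c t s) s.

Definition energy (H : cotangent -> R -> R) (g : R -> R -> cotangent) (s : R) : R :=
  \int[lebesgue_measure]_(t in `[0, 1]) H (g t s) 0.

Definition curve_xs (g : R -> R -> cotangent) c (t s : R) : 'rV[R]_n :=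
  derive1 (fun s' => curve_x g c t s') s.

(* <xi(t; s), x_s(t; s)> in the chart c; the laws of change of chart for
   covectors and for velocities make it independent of c. *)
Definition pairing_xs (g : R -> R -> cotangent) c (t s : R) : R :=
  \sum_(i < n) curve_xi g c t s 0 i * curve_xs g c t s 0 i.

Definition H_s (H : cotangent -> R -> R) (z : cotangent) (s : R) : R :=
  derive1 (H z) s.

End Cotangent.

Lemma line_cvg (R : realType) (V : normedModType R) (a v : V) :
  (fun h : R => a + h *: v) @ (0 : R)^' --> a.
Proof.
apply: cvg_trans (_ : (fun h : R => a + h *: v) @ (0 : R) --> a).
  by apply: cvg_app; apply: cvg_within.
rewrite -[X in _ --> X]addr0 -[X in _ --> _ + X](scale0r v).
by apply: cvgD; [exact: cvg_cst|apply: cvgZr_tmp; exact: cvg_id].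
Qed.

Lemma derive_inE (R : realType) (V W : normedModType R) (A : set V)
    (f g : V -> W) (a v : V) :
  ProperFilter (within [set h : R | A (a + h *: v)] 0^') ->
  differentiable g a -> (\forall y \near a, A y -> f y = g y) -> A a ->
  derive_in A f a v = 'd g a v.
Proof.
move=> PF dg fg Aa.
have fga : f a = g a by apply: (nbhs_singleton fg).
rewrite -deriveE//; apply/cvg_lim; first exact: norm_hausdorff.
have dv : derivable g a v by apply: diff_derivable.
have H : (fun h : R => h^-1 *: (g (a + h *: v) - g a)) @
    within [set h : R | A (a + h *: v)] 0^' --> 'D_v g a.
  apply: cvg_trans (_ : (fun h : R => h^-1 *: (g (a + h *: v) - g a)) @ 0^' --> _).
    by apply: cvg_app; apply: cvg_within.
  have -> : (fun h : R => h^-1 *: (g (a + h *: v) - g a)) = (fun h : R => h^-1 *: ((g \o shift a) (h *: v) - g a)).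
    by apply/funext => h /=; rewrite (addrC a).
  exact: dv.
apply: (cvg_trans _ H).
apply: near_eq_cvg.
have /= K := @line_cvg _ _ a v _ fg.
have K1 : \forall h \near (0:R)^', A (a + h *: v) -> f (a + h *: v) = g (a + h *: v) by exact: K.
rewrite near_withinE; near=> h => /= Ah; rewrite fga (near K1 h)//.
Unshelve. all: by end_near. Qed.

Lemma half_proper (R : realType) (n : nat) (A : set 'rV[R]_n) a i :
  (\forall y \near a, half_space y -> A y) -> half_space a ->
  ProperFilter (within [set h : R | A (a + h *: @unit_vec R n i)] 0^').
Proof.
move=> Aa ha; apply: Build_ProperFilter_ex => /= B.
rewrite /within/= => HB.
have /= K := @line_cvg _ _ a (@unit_vec R n i) _ Aa.
have K1 : \forall h \near (0:R)^', half_space (a + h *: @unit_vec R n i) -> A (a + h *: @unit_vec R n i) by exact: K.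
have HH : \forall h \near (0:R)^'+, B h.
  have s : (0:R)^'+ `=>` (0:R)^'.
    move=> X; rewrite /dnbhs /at_right /within/=; apply: filterS => h Xh h0.
    by apply: Xh; rewrite gt_eqF.
  have := s _ HB; have := s _ K1.
  move=> K2 HB2; near=> h.
  have h0 : 0 < h by near: h; exact: nbhs_right_gt.
  apply: (near HB2 h) => //=; apply: (near K2 h) => // j jn.
  rewrite !mxE addr_ge0 ?(ha j)// mulr_ge0 ?ler0n// ltW.
by apply: (@filter_ex _ _ (at_right_proper_filter (0:R)) _ HH).
Unshelve. all: by end_near. Qed.

Section CotangentCharts.
Context (R : realType) (n : nat) (M : manifold R n).
Implicit Types (c d : chart M) (p : M).

Lemma near_img c (B : set M) p : chart_dom c p -> open B -> B p ->
  \forall y \near chart_map c p, half_space y ->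
    (chart_map c @` (chart_dom c `&` B)) y.
Proof.
move=> cp oB Bp.
have [U oU eU] := chart_img_open c.
have im : (chart_map c @` chart_dom c) (chart_map c p) by exists p.
have H2 : \forall y \near chart_map c p, (chart_map c @` chart_dom c) y -> B (chart_inv c y).
  have nB : nbhs (chart_inv c (chart_map c p)) B.
    by rewrite chart_mapK//; exact: open_nbhs_nbhs.
  have := @chart_inv_cont _ _ M c (chart_map c p) B nB.
  by rewrite /nbhs/= /nbhs/= -(nbhs_subspace_in im).
have UU : \forall y \near chart_map c p, U y.
  by apply: open_nbhs_nbhs; split=> //; move: im; rewrite eU => -[].
near=> y => hy.
have [q cq qy] : (chart_map c @` chart_dom c) y by rewrite eU; split=> //; near: y.
exists q => //; split=> //.
have : B (chart_inv c y) by apply: (near H2 y) => //; exists q.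
by rewrite -qy chart_mapK.
Unshelve. all: by end_near. Qed.

Lemma in_half c p : chart_dom c p -> half_space (chart_map c p).
Proof.
move=> cp; have [U oU eU] := chart_img_open c.
have : (chart_map c @` chart_dom c) (chart_map c p) by exists p.
by rewrite eU => -[].
Qed.

Lemma jacE c d p : chart_dom c p -> chart_dom d p ->
  exists G : 'rV[R]_n -> 'rV[R]_n,
   [/\ differentiable G (chart_map c p),
     (\forall q \near chart_map c p,
        (chart_map c @` (chart_dom c `&` chart_dom d)) q ->
        chart_map d (chart_inv c q) = G q) &
     forall v, 'd G (chart_map c p) v = v *m jac c d p].
Proof.
move=> cp dp.
have Ap : (chart_map c @` (chart_dom c `&` chart_dom d)) (chart_map c p) by exists p.
have [U [G [oU Up CG GE]]] := chart_transition Ap.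
have dG : differentiable G (chart_map c p) by have [+ _] := CG 1%N; apply.
have nG : (\forall q \near chart_map c p,
        (chart_map c @` (chart_dom c `&` chart_dom d)) q ->
        chart_map d (chart_inv c q) = G q).
  have UU : \forall y \near chart_map c p, U y by exact: open_nbhs_nbhs.
  by near=> q => Aq; rewrite GE//; near: q.
exists G; split=> // v.
have e i : 'd G (chart_map c p) (@unit_vec R n i) = row i (jac c d p).
  rewrite /jac rowK -(derive_inE (f:=fun y => chart_map d (chart_inv c y)) _ dG nG Ap)//.
  apply: half_proper; last exact: in_half.
  by apply: near_img => //; exact: chart_dom_open.
rewrite [in LHS](row_sum_delta v) linear_sum /= mulmx_sum_row.
by apply: eq_bigr => i _; rewrite linearZ/= e.
Unshelve. all: by end_near. Qed.

Lemma jac_mul c d f p : chart_dom c p -> chart_dom d p -> chart_dom f p ->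
  jac c f p = jac c d p *m jac d f p.
Proof.
move=> cp dp fp.
have [G1 [dG1 E1 J1]] := jacE cp dp.
have [G2 [dG2 E2 J2]] := jacE dp fp.
have Ap : (chart_map c @` (chart_dom c `&` chart_dom f)) (chart_map c p) by exists p.
have G1p : G1 (chart_map c p) = chart_map d p.
  by rewrite -(nbhs_singleton E1) ?chart_mapK//; exists p.
rewrite -G1p in dG2 E2 J2.
apply/row_matrixP => i; rewrite rowE [RHS]rowE mulmxA -J1 -J2.
have -> : delta_mx 0 i *m jac c f p = row i (jac c f p) by rewrite rowE.
rewrite rowK.
transitivity ('d (G2 \o G1) (chart_map c p) (@unit_vec R n i)); last first.
  have E := diff_comp dG1 dG2.
  exact: (congr1 (fun f => f (@unit_vec R n i)) E).
apply: derive_inE => //.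
- apply: half_proper; last exact: in_half.
  by apply: near_img => //; exact: chart_dom_open.
- exact: differentiable_comp.
have N1 := near_img cp (chart_dom_open d) dp.
have N2 := near_img dp (chart_dom_open f) fp.
have cG := differentiable_continuous dG1.
have E2' : \forall q \near chart_map c p,
   (chart_map d @` (chart_dom d `&` chart_dom f)) (G1 q) ->
        chart_map f (chart_inv d (G1 q)) = G2 (G1 q) by exact: (cG _ E2).
near=> y => -[q [cq fq] qy].
have [r [cr dr] ry] : (chart_map c @` (chart_dom c `&` chart_dom d)) y.
  by apply: (near N1 y) => //; rewrite -qy; exact: in_half.
have rq : r = q by rewrite -(chart_mapK cr) -(chart_mapK cq) ry qy.
subst r.
have g1 : G1 y = chart_map d q.
  by rewrite -(near E1 y)//; [rewrite -qy chart_mapK|exists q].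
rewrite /= -(near E2' y) //; first by rewrite g1 -qy !chart_mapK.
by rewrite g1; exists q.
Unshelve. all: by end_near. Qed.

Lemma jac_id c p : chart_dom c p -> jac c c p = 1%:M.
Proof.
move=> cp.
apply/row_matrixP => i; rewrite rowK row1.
have Ap : (chart_map c @` (chart_dom c `&` chart_dom c)) (chart_map c p) by exists p.
have PF : ProperFilter (within [set h : R | (chart_map c @` (chart_dom c `&` chart_dom c))
   (chart_map c p + h *: @unit_vec R n i)] 0^').
  apply: half_proper; last exact: in_half.
  by apply: near_img => //; exact: chart_dom_open.
have nE : \forall y \near chart_map c p, (chart_map c @` (chart_dom c `&` chart_dom c)) y ->
    chart_map c (chart_inv c y) = id y.
  by near=> y => -[q [cq _] <-]; rewrite chart_mapK.
rewrite (@derive_inE _ _ _ _ (fun y => chart_map c (chart_inv c y)) id _ _ PF _ nE Ap).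
- by have [_ ->] := is_diff_id (chart_map c p).
- by have [+ _] := is_diff_id (chart_map c p).
Unshelve. all: by end_near. Qed.

Lemma cotangent_exists c p xi : chart_dom c p ->
  exists z : cotangent M, base_pt z = p /\ covec z c = xi.
Proof.
move=> cp.
pose f d := if pselect (chart_dom d p) then xi *m (jac d c p)^T else 0.
have fl d e : chart_dom d p -> chart_dom e p -> f d = f e *m (jac d e p)^T.
  move=> dp ep; rewrite /f.
  case: (pselect (chart_dom d p)) => [?|/(_ dp)//].
  case: (pselect (chart_dom e p)) => [?|/(_ ep)//].
  by rewrite -mulmxA -trmx_mul -jac_mul.
have fo d : ~ chart_dom d p -> f d = 0 by rewrite /f; case: pselect.
exists (Cotangent fl fo); split => //=.
by rewrite /f; case: (pselect _) => // ?; rewrite jac_id// trmx1 mulmx1.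
Qed.

Lemma cotangent_eq c (z w : cotangent M) : chart_dom c (base_pt z) ->
  base_pt z = base_pt w -> covec z c = covec w c -> z = w.
Proof.
case: z => p f fl fo; case: w => q g gl go /= cp pq; subst q => fg.
have E : f = g.
  apply/funext => d; have [dp|dp] := pselect (chart_dom d p).
    by rewrite (fl d c)// (gl d c)// fg.
  by rewrite fo// go.
by subst g; congr Cotangent; exact: Prop_irrelevance.
Qed.

Lemma local_repE (H : cotangent M -> R -> R) c z s : chart_dom c (base_pt z) ->
  local_rep H c (chart_map c (base_pt z)) (covec z c) s = H z s.
Proof.
move=> cz; rewrite /local_rep; case: xgetP => [r _ [w [cw wz e] ->]|/(_ (H z s))]; last first.
  by case; exists z.
congr (H _ s); apply: (cotangent_eq cw) => //.
by rewrite -(chart_mapK cw) wz chart_mapK.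
Qed.
End CotangentCharts.

(* Main.v *)
Require Import Defs.
From mathcomp Require Import all_boot all_order all_algebra.
From mathcomp Require Import all_classical all_reals all_analysis.
From mathcomp Require Import ring lra.

Set Implicit Arguments.
Unset Strict Implicit.
Unset Printing Implicit Defensive.
Import Order.TTheory GRing.Theory Num.Theory.
Import numFieldNormedType.Exports.

Local Open Scope classical_set_scope.
Local Open Scope ring_scope.

(** Write x_t, x_s, xi_t, xi_s for the partial derivatives of the curves.  Euler's
    identity for functions homogeneous of degree two in xi is
      [<xi, H_xi> = 2 H],
    so the equation x_t = H_xi gives, for every s,
      [<xi, x_t> = 2 H(x, xi; s)].
    Differentiating this in s at s = 0, and writing D for the s-derivative of the
    unperturbed energy density H(x, xi; 0),
      [<xi_s, x_t> + <xi, x_ts> = 2 (D + H_s)].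
    On the other hand x_t = H_xi and xi_t = - H_x give
      [D = <H_x, x_s> + <H_xi, xi_s> = <xi_s, x_t> - <xi_t, x_s>].
    Subtracting the second relation from the first, and using x_ts = x_st,
      [d/dt <xi, x_s> = D + 2 H_s]
    at s = 0.  This is [energy_identity]; it is integrated over the time interval by
    the fundamental theorem of calculus, and the integral of D is the derivative of
    the energy by differentiation under the integral sign.

    The computation takes place in a chart around one time t0.  Since that time may be an
    end of the interval, and the base point may lie on the boundary of the manifold, the
    curves and the Hamiltonian are first replaced by smooth maps on open sets that
    extend them ([local_model]).  Identities with a time derivative are needed at
    interior times only, where the time derivative of the curve is an ordinary one; at the
    two ends continuity is enough.  The pieces fit together because the pairing
    <xi, x_s> does not depend on the chart ([pairing_chart_indep]): covectors
    and velocities change by transposed Jacobian matrices.  Compactness of the time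
    interval makes the local bounds on the s-derivative uniform ([is_derive_integral]).

    The equality x_ts = x_st is Schwarz's theorem, proved here by applying the
    mean value theorem twice to a second difference ([square_increment] and
    [mixed_derive_eq]). *)

(** * Symmetry of mixed directional derivatives *)

Section DirectionalDerivatives.
Context (R : realType) (V : normedModType R).

Lemma is_derive_line (W : normedModType R) (f : V -> W) (a v : V) (r : R) df :
  is_derive (a + r *: v) v f df -> is_derive r 1 (fun q : R => f (a + q *: v)) df.
Proof.
move=> [ex val].
have E : (fun h : R => h^-1 *: (((fun q : R => f (a + q *: v)) \o shift r) (h *: 1) -
     f (a + r *: v))) =
  (fun h : R => h^-1 *: ((f \o shift (a + r *: v)) (h *: v) - f (a + r *: v))).
  apply/funext => h /=; congr (_ *: (f _ - _)).
  by rewrite [h%:A]mulr1 scalerDl addrCA.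
by split; rewrite /derivable /derive E.
Qed.

(** The second difference over the parallelogram spanned by h u and h v is, by the mean
    value theorem along u and then along v, exactly h^2 times the mixed derivative at
    some point of the parallelogram, hence close to h^2 times its value at the corner. *)
Lemma square_increment (f fu fuv : V -> R) (a u v : V) (eps : R) : 0 < eps ->
  (\forall x \near a, is_derive x u f (fu x)) ->
  (\forall x \near a, is_derive x v fu (fuv x)) ->
  {for a, continuous fuv} ->
  \forall h \near (0 : R)^'+,
    `|f (a + h *: u + h *: v) - f (a + h *: u) - f (a + h *: v) + f a
      - h ^+ 2 * fuv a| <= eps * h ^+ 2.
Proof.
move=> eps0 Df Dfu cfuv.
pose P x := [/\ is_derive x u f (fu x), is_derive x v fu (fuv x) &
                `|fuv a - fuv x| <= eps].
have nP : \forall x \near a, P x.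
  near=> x; split; [near: x; exact: Df|near: x; exact: Dfu|].
  by near: x; move/cvgrPdist_le : cfuv; exact.
have cS : (fun p : R * R => a + p.1 *: u + p.2 *: v) @ (0 : R * R) --> a.
  rewrite -[X in _ --> X]addr0 -[X in _ --> _ + X](scale0r v).
  apply: cvgD; last by apply: cvgZr_tmp; exact: cvg_snd.
  rewrite -[X in _ --> X]addr0 -[X in _ --> _ + X](scale0r u).
  by apply: cvgD; [exact: cvg_cst|apply: cvgZr_tmp; exact: cvg_fst].
have /nbhs_ballP[d /= d0 dP] := cS _ nP.
have {}dP p q : 0 <= p < d -> 0 <= q < d -> P (a + p *: u + q *: v).
  move=> /andP[p0 pd] /andP[q0 qd]; apply: (dP (p, q)).
  by split; rewrite /ball/= sub0r normrN ger0_norm.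
near=> h.
have h0 : 0 < h by near: h; exact: nbhs_right_gt.
have hd : h < d by near: h; exact: nbhs_right_lt.
pose F (p : R) := f (a + h *: v + p *: u) - f (a + p *: u).
pose F' (p : R) := fu (a + h *: v + p *: u) - fu (a + p *: u).
have DF p : 0 <= p <= h -> is_derive p 1 F (F' p).
  move=> /andP[p0 ph]; apply: is_deriveB; apply: is_derive_line.
    have [+ _ _] : P (a + p *: u + h *: v).
      by apply: dP; rewrite ?p0 ?(le_lt_trans ph)// (ltW h0) hd.
    by rewrite addrAC.
  have [+ _ _] : P (a + p *: u + 0 *: v).
    by apply: dP; rewrite ?p0 ?(le_lt_trans ph)// lexx (lt_trans h0).
  by rewrite scale0r addr0.
have [p ph Fp] : exists2 p, p \in `]0, h[ & F h - F 0 = F' p * (h - 0).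
  apply: MVT => //.
    by move=> p /[!in_itv]/= /andP[p0 ph]; apply: DF; rewrite !ltW.
  apply: derivable_within_continuous => p /[!in_itv]/= /DF[//].
have {ph} /andP[p0 ph] : 0 < p < h by rewrite in_itv in ph.
have DG q : 0 <= q <= h ->
    is_derive q 1 (fun q : R => fu (a + p *: u + q *: v)) (fuv (a + p *: u + q *: v)).
  move=> /andP[q0 qh]; apply: is_derive_line.
  have [_ + _] : P (a + p *: u + q *: v).
    by apply: dP; [rewrite ltW//= (lt_trans ph)|rewrite q0 (le_lt_trans qh)].
  by [].
have [q qh Gq] : exists2 q, q \in `]0, h[ &
    fu (a + p *: u + h *: v) - fu (a + p *: u + 0 *: v) =
    fuv (a + p *: u + q *: v) * (h - 0).
  apply: (MVT (f := fun q : R => fu (a + p *: u + q *: v))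
    (df := fun q : R => fuv (a + p *: u + q *: v))) => //.
    by move=> q /[!in_itv]/= /andP[q0 qh]; apply: DG; rewrite !ltW.
  apply: derivable_within_continuous => q /[!in_itv]/= /DG[//].
have {qh} /andP[q0 qh] : 0 < q < h by rewrite in_itv in qh.
have -> : f (a + h *: u + h *: v) - f (a + h *: u) - f (a + h *: v) + f a =
    F h - F 0.
  rewrite /F !scale0r !addr0 opprB addrA (addrAC a (h *: v)).
  by rewrite -!addrA; congr (_ + (_ + _)); rewrite addrC.
have -> : F h - F 0 = h ^+ 2 * fuv (a + p *: u + q *: v).
  rewrite Fp /F' (addrAC a (h *: v)) -[X in _ - fu X]addr0 -(scale0r v) Gq.
  by rewrite subr0 -mulrA mulrC expr2.
rewrite -mulrBr normrM (ger0_norm (sqr_ge0 h)) mulrC ler_wpM2r ?sqr_ge0//.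
rewrite distrC.
have [_ _ //] : P (a + p *: u + q *: v).
by apply: dP; rewrite ltW//= ?(lt_trans ph) ?(lt_trans qh).
Unshelve. all: by end_near. Qed.

(** The second difference is symmetric in u and v, while [square_increment] estimates it
    by either mixed derivative.  The derivatives are given as functions that need only
    be derivatives near the point, so that the lemma applies to coordinates of
    vector-valued maps. *)
Lemma mixed_derive_eq (f fu fv fuv fvu : V -> R) (a u v : V) :
  (\forall x \near a, is_derive x u f (fu x)) ->
  (\forall x \near a, is_derive x v f (fv x)) ->
  (\forall x \near a, is_derive x v fu (fuv x)) ->
  (\forall x \near a, is_derive x u fv (fvu x)) ->
  {for a, continuous fuv} -> {for a, continuous fvu} ->
  fuv a = fvu a.
Proof.
move=> Du Dv Duv Dvu cuv cvu; apply/eqP; rewrite -subr_eq0 -normr_le0.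
apply/ler_addgt0Pl => eps eps0; rewrite addr0.
have e20 : 0 < eps / 2 by rewrite divr_gt0.
have near1 := square_increment e20 Du Duv cuv.
have near2 := square_increment e20 Dv Dvu cvu.
have [h [h0 /= h1 h2]] : exists h : R, [/\ 0 < h,
    `|f (a + h *: u + h *: v) - f (a + h *: u) - f (a + h *: v) + f a
      - h ^+ 2 * fuv a| <= eps / 2 * h ^+ 2 &
    `|f (a + h *: v + h *: u) - f (a + h *: v) - f (a + h *: u) + f a
      - h ^+ 2 * fvu a| <= eps / 2 * h ^+ 2].
  have := @filter_ex _ _ (at_right_proper_filter (0 : R)).
  apply; near=> h; split.
  - by near: h; exact: nbhs_right_gt.
  - by near: h; exact: near1.
  - by near: h; exact: near2.
have h20 : 0 < h ^+ 2 by rewrite exprn_gt0.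
rewrite -(ler_pM2r h20) -[X in _ * X <= _](ger0_norm (ltW h20)) -normrM.
rewrite (splitr eps) [leRHS]mulrDl.
rewrite (addrAC (a)) (addrAC (f _)) in h2.
set Q := _ + f a in h1 h2.
have -> : (fuv a - fvu a) * h ^+ 2 = (Q - h ^+ 2 * fvu a) - (Q - h ^+ 2 * fuv a).
  by ring.
by rewrite (le_trans (ler_normB _ _))// addrC lerD.
Unshelve. all: by end_near. Qed.

End DirectionalDerivatives.

(** * Derivatives along lines, slices and compositions *)

Lemma cvg_prod (T : Type) (F : set_system T) (X Y : topologicalType) (f : T -> X)
    (g : T -> Y) (x : X) (y : Y) : Filter F -> f @ F --> x -> g @ F --> y ->
  (fun z => (f z, g z)) @ F --> (x, y).
Proof. by move=> FF fx gy; exact: (cvg_pair (G := nbhs x) (H := nbhs y)). Qed.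

Lemma is_derive_product (R : realType) (V : normedModType R) (f g : V -> R) (x v : V)
    (df dg : R) : is_derive x v f df -> is_derive x v g dg ->
  is_derive x v (fun y => f y * g y) (df * g x + f x * dg).
Proof.
move=> Df Dg; apply: (is_derive_eq (is_deriveM Df Dg)).
by rewrite addrC; congr (_ + _); exact: mulrC.
Qed.

Lemma is_derive_scale (R : realType) (V : normedModType R) (a : R) (f : V -> R) (x v : V)
    (df : R) : is_derive x v f df -> is_derive x v (fun y => a * f y) (a * df).
Proof. by move=> Df; apply: (is_derive_eq (is_deriveZ a Df)). Qed.

Lemma is_derive_diff_comp (R : realType) (V W : normedModType R) (f : R -> V) (T : V -> W)
    (r : R) (df : V) : differentiable T (f r) -> is_derive r 1 f df ->
  is_derive r 1 (fun q => T (f q)) ('d T (f r) df).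
Proof.
move=> dT [vf <-]; have dif : differentiable f r by exact/derivable1_diffP.
have dc : differentiable (T \o f) r by exact: differentiable_comp.
split; first exact/derivable1_diffP.
by rewrite -[LHS]/('D_1 (T \o f) r) !deriveE// diff_comp.
Qed.

Lemma is_derive_sum_fun (R : realType) (V : normedModType R) n (f : 'I_n -> V -> R)
    (x v : V) (df : 'I_n -> R) : (forall i, is_derive x v (f i) (df i)) ->
  is_derive x v (fun y => \sum_(i < n) f i y) (\sum_(i < n) df i).
Proof.
move=> Df; have := is_derive_sum Df.
by congr is_derive; apply/funext => y; rewrite fct_sumE.
Qed.

(** A map that is affine along the line through x directed by v turns the
    derivative along v into a derivative along the image of v. *)
Lemma derive_reparam (R : realType) (V V' W : normedModType R) (f : V' -> W)
    (j : V -> V') (x v : V) (w : V') :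
  (forall h : R, j (h *: v + x) = h *: w + j x) ->
  'D_v (fun y => f (j y)) x = 'D_w f (j x).
Proof.
move=> jE; rewrite /derive; set q := (fun _ : R => _); set q' := (fun _ : R => _).
by have -> : q = q' by apply/funext => h; rewrite /q /q'/= jE.
Qed.

Lemma slice2_cvg (X Y : topologicalType) (x : X) (y : Y) :
  (fun y' => (x, y')) @ y --> (x, y).
Proof. by apply: (cvg_prod (F := nbhs y)); [exact: cvg_cst|exact: cvg_id]. Qed.

Lemma slice1_cvg (X Y : topologicalType) (x : X) (y : Y) :
  (fun x' => (x', y)) @ x --> (x, y).
Proof. by apply: (cvg_prod (F := nbhs x)); [exact: cvg_id|exact: cvg_cst]. Qed.

Lemma continuous_slice1 (X Y Z : topologicalType) (f : X * Y -> Z) (x : X) (y : Y) :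
  {for (x, y), continuous f} -> {for x, continuous (fun x' => f (x', y))}.
Proof. by move=> cf; apply: (cvg_comp (fun x' => (x', y)) f _ cf); exact: slice1_cvg. Qed.

Section Slices.
Context (R : realType).

Lemma is_derive_slice2 (W : normedModType R) (F : R * R -> W) (t s : R) dF :
  is_derive (t, s) (0 : R, 1 : R) F dF -> is_derive s 1 (fun s' => F (t, s')) dF.
Proof.
have lineE r : (t, 0) + r *: ((0 : R), (1 : R)) = (t, r).
  by congr pair; rewrite /= ?scaler0 ?addr0 // add0r [_%:A]mulr1.
rewrite -(lineE s) => /is_derive_line.
by congr is_derive; apply/funext => r; rewrite lineE.
Qed.

Lemma is_derive_slice1 (W : normedModType R) (F : R * R -> W) (t s : R) dF :
  is_derive (t, s) (1 : R, 0 : R) F dF -> is_derive t 1 (fun t' => F (t', s)) dF.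
Proof.
have lineE r : (0, s) + r *: ((1 : R), (0 : R)) = (r, s).
  by congr pair; rewrite /= ?scaler0 ?addr0 // add0r [_%:A]mulr1.
rewrite -(lineE t) => /is_derive_line.
by congr is_derive; apply/funext => r; rewrite lineE.
Qed.

End Slices.

(** * Integrals over the time interval of locally defined functions *)

Section Integral.
Context (R : realType).

Lemma local_within_continuous (A : set R) (f : R -> R) :
  (forall t, A t -> exists2 G : R -> R, {for t, continuous G} &
    \forall t' \near t, A t' -> f t' = G t') ->
  {within A, continuous f}.
Proof.
move=> loc; apply/subspace_continuousP => t At.
have [G cG fG] := loc t At.
have ftG : f t = G t by exact: (nbhs_singleton fG).
suff : f @ within A (nbhs t) --> G t by rewrite -ftG.
apply: cvg_trans (_ : G @ within A (nbhs t) --> G t); last exact: cvg_within_filter.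
apply: near_eq_cvg; rewrite near_withinE.
by near=> t' => At'; apply/esym; apply: (near fG t').
Unshelve. all: by end_near. Qed.

(** Differentiation under the integral sign for an integrand that is known only locally
    to be the restriction of a function F whose s-derivative DF is continuous: by
    compactness of the time interval, finitely many of the local bounds on DF give
    one bound and one interval of parameters valid at all times, and a constant
    dominates the difference quotients. *)
Lemma is_derive_integral (f : R -> R -> R) :
  (forall t : R, 0 <= t <= 1 -> exists F DF : R * R -> R,
    \forall u \near (t : R, 0 : R), [/\ is_derive u (0 : R, 1 : R) F (DF u),
      {for u, continuous F}, {for u, continuous DF} &
      0 <= u.1 <= 1 -> f u.1 u.2 = F u]) ->
  is_derive (0 : R) 1 (fun s => \int[lebesgue_measure]_(t in `[0, 1]) f t s)
    (\int[lebesgue_measure]_(t in `[0, 1]) derive1 (f t) 0).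
Proof.
move=> loc.
(* An index i is a pair (bound, parameter).  Bounds range over a neighbourhood of
   +oo, so that a bound chosen near one time can be enlarged to serve all times. *)
pose good i t := [/\ derivable (f t) i.2 1, `|derive1 (f t) i.2| <= i.1 &
  exists2 G : R -> R, {for t, continuous G} &
    \forall t' \near t, `[0, 1]%classic t' -> f t' i.2 = G t'].
have unif : \forall i \near filter_prod (pinfty_nbhs R) (nbhs (0 : R)),
    (`[0, 1] : set R) `<=` good i.
  have /compact_near_coveringP/near_covering_withinP := @segment_compact R 0 1.
  apply => t /=; rewrite in_itv/= => t01.
  have [F [DF FDF]] := loc t t01.
  have bDF : \forall u \near (t, 0 : R), `|DF u| <= `|DF (t, 0)| + 1.
    have [_ _ cDF _] := nbhs_singleton FDF.
    have /cvgrPdist_le/(_ 1 ltr01) := cDF.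
    apply: filterS => u le1; rewrite -lerBlDl.
    by rewrite (le_trans _ le1)// distrC lerB_dist.
  pose P u := [/\ is_derive u (0 : R, 1 : R) F (DF u), {for u, continuous F},
    {for u, continuous DF} & 0 <= u.1 <= 1 -> f u.1 u.2 = F u] /\
    `|DF u| <= `|DF (t, 0)| + 1.
  have nP : \forall u \near (t, 0 : R), P u by exact: (filterI FDF bDF).
  have [[Q1 Q2] /= [nQ1 nQ2] Q12] := nbhs_interior nP.
  exists (Q1, fun i => `|DF (t, 0)| + 1 <= i.1 /\ Q2 i.2) => /=.
    split => //; exists ([set B | `|DF (t, 0)| + 1 <= B], Q2) => //=.
    by split => //; exact: nbhs_pinfty_ge.
  move=> [t' [B s]] /= [Qt' [B1 Qs]]; rewrite in_itv/= => t'01.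
  have near_u := Q12 (t', s) (conj Qt' Qs).
  have slice_s : \forall s' \near s, F (t', s') = f t' s'.
    have P2 : \forall s' \near s, P (t', s') := @slice2_cvg R R t' s _ near_u.
    apply: filterS P2 => s' [[_ _ _ /=]] fF _.
    by rewrite -fF.
  have [[dF cF _ _] bD] := nbhs_singleton near_u.
  have df : is_derive s 1 (f t') (DF (t', s)).
    by apply: near_eq_is_derive slice_s _; exact: is_derive_slice2.
  split => /=.
  - by case: df.
  - by rewrite derive1E; case: df => _ ->; apply: le_trans B1.
  - exists (fun t' => F (t', s)).
      exact: continuous_slice1 cF.
    have P1 : \forall t' \near t', P (t', s) := @slice1_cvg R R t' s _ near_u.
    apply: filterS P1 => t'' [[_ _ _ /=]] fF _.
    by rewrite in_itv.
have [[Q1 Q2] /= [nQ1 nQ2] Q12] := unif.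
have [B QB] : exists B, Q1 B by have /filter_ex := nQ1.
have /nbhs_ballP[d /= d0 dQ] := nQ2.
have {unif nQ1 nQ2}good_B s t : `]- d, d[%classic s -> `[0, 1]%classic t -> good (B, s) t.
  rewrite /= in_itv/= => sd; apply: (Q12 (B, s)); split => //; apply: dQ.
  by rewrite /ball/= sub0r normrN ltr_norml.
have I0 : `]- d, d[%classic (0 : R) by rewrite /= in_itv/= oppr_lt0 d0.
have intf s : `]- d, d[%classic s ->
    lebesgue_measure.-integrable `[0, 1] (EFin \o (f ^~ s)).
  move=> sd; apply: continuous_compact_integrable; first exact: segment_compact.
  by apply: local_within_continuous => t t01; have [] := good_B s t sd t01.
have Bge0 : 0 <= B.
  have /(good_B 0)[//|_ + _] : `[0, 1]%classic (0 : R) by rewrite /= in_itv/= lexx ler01.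
  by apply: le_trans.
have der s t : `]- d, d[%classic s -> `[0, 1]%classic t -> derivable (f t) s 1.
  by move=> sd t01; have [] := good_B s t sd t01.
have bnd s t : `]- d, d[%classic s -> `[0, 1]%classic t -> `|derive1 (f t) s| <= B.
  by move=> sd t01; have [] := good_B s t sd t01.
have mI : measurable (`[0, 1]%classic : set R) by exact: measurable_itv.
have intB : lebesgue_measure.-integrable `[0, 1] (EFin \o cst B : R -> _).
  apply: continuous_compact_integrable; first exact: segment_compact.
  by apply: continuous_subspaceT => x; exact: cvg_cst.
have D := @cvg_differentiation_under_integral R _ _ lebesgue_measure
  (fun s t => f t s) `[0, 1]%classic mI 0 (- d) d I0 intf der (cst B)
  (fun=> Bge0) intB bnd.
set F := fun s : R => _.
set I := (X in is_derive _ _ _ X).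
have E : (fun h : R => h^-1 *: ((F \o shift 0) (h *: 1) - F 0)) =
    (fun h : R => h^-1 *: (F (h + 0) - F 0)).
  by apply/funext => h /=; rewrite [h%:A]mulr1.
have {E}D : (fun h : R => h^-1 *: ((F \o shift 0) (h *: 1) - F 0)) @ (0 : R)^' --> I.
  by rewrite E; exact: D.
by split; [apply/cvg_ex; eexists; exact: D|apply/cvg_lim => //; exact: D].
Qed.

(** The fundamental theorem of calculus for P' = rate + k S, when the three functions
    are described by a different formula near each time, and the equation holds at
    interior times only. *)
Lemma integral_rate_balance (k : R) (P rate S : R -> R) :
  (forall t : R, 0 <= t <= 1 -> exists Pl ratel Sl : R -> R,
    [/\ \forall t' \near t, 0 <= t' <= 1 ->
          [/\ P t' = Pl t', rate t' = ratel t' & S t' = Sl t'],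
      [/\ {for t, continuous Pl}, {for t, continuous ratel} & {for t, continuous Sl}] &
      0 < t < 1 -> is_derive t 1 Pl (ratel t + k * Sl t)]) ->
  \int[lebesgue_measure]_(t in `[0, 1]) rate t =
  P 1 - P 0 - k * \int[lebesgue_measure]_(t in `[0, 1]) S t.
Proof.
move=> local.
have cP : {within `[0, 1], continuous P}.
  apply: local_within_continuous => t; rewrite /= in_itv/= => t01.
  have [Pl [ratel [Sl [nE [cPl cr cS] dE]]]] := local t t01.
  by exists Pl => //; apply: filterS nE => t' nE; rewrite in_itv/= => /nE[].
have crate : {within `[0, 1], continuous rate}.
  apply: local_within_continuous => t; rewrite /= in_itv/= => t01.
  have [Pl [ratel [Sl [nE [cPl cr cS] dE]]]] := local t t01.
  by exists ratel => //; apply: filterS nE => t' nE; rewrite in_itv/= => /nE[].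
have cS : {within `[0, 1], continuous S}.
  apply: local_within_continuous => t; rewrite /= in_itv/= => t01.
  have [Pl [ratel [Sl [nE [cPl cr cS] dE]]]] := local t t01.
  by exists Sl => //; apply: filterS nE => t' nE; rewrite in_itv/= => /nE[].
have dP (t : R) : 0 < t < 1 -> is_derive t 1 P (rate t + k * S t).
  move=> t01; have /andP[/ltW t0 /ltW t1] := t01.
  have t01' : 0 <= t <= 1 by rewrite t0.
  have [Pl [ratel [Sl [nE _ /(_ t01) dPl]]]] := local t t01'.
  have [_ -> ->] := nbhs_singleton nE t01'.
  apply: near_eq_is_derive dPl.
  near=> t'.
  have t'01 : 0 <= t' <= 1.
    by apply/andP; split; apply: ltW; near: t'; move/andP: t01 => [? ?];
      [exact: lt_nbhsr|exact: lt_nbhsl].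
  have [-> //] : [/\ P t' = Pl t', rate t' = ratel t' & S t' = Sl t'].
  by move: t'01; near: t'; exact: nE.
have mI : measurable (`[0, 1]%classic : set R) by exact: measurable_itv.
have intc (f : R -> R) : {within `[0, 1], continuous f} ->
    lebesgue_measure.-integrable (`[0, 1]%classic : set R) (EFin \o f).
  by move=> cf; apply: continuous_compact_integrable => //; exact: segment_compact.
have ckS : {within `[0, 1], continuous (fun t => k * S t)}.
  by move=> t; apply: cvgM; [exact: cvg_cst|exact: cS].
have crkS : {within `[0, 1], continuous (fun t => rate t + k * S t)}.
  by move=> t; apply: cvgD; [exact: crate|exact: ckS].
have FTC : \int[lebesgue_measure]_(t in `[0, 1]) (rate t + k * S t) = P 1 - P 0.
  have P01 : derivable_oo_LRcontinuous P 0 1.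
    have /(continuous_within_itvP _ ltr01)[_ P0 P1] := cP.
    by split => // t; rewrite in_itv/= => /dP[].
  rewrite /Rintegral (continuous_FTC2 ltr01 crkS P01)// => t.
  by rewrite in_itv/= derive1E => /dP[_ ->].
by rewrite -FTC RintegralD//; [rewrite RintegralZl ?addrK//; exact: intc|exact: intc..].
Unshelve. all: by end_near. Qed.

End Integral.

(** * Smooth maps and the chain rule in phase space *)

Section Smooth.
Context (R : realType) (V W : normedModType R).
Implicit Types (U : set V) (f : V -> W).

Lemma smooth_differentiable U f x : (forall k, Ck k U f) -> U x -> differentiable f x.
Proof. by move=> /(_ 1%N)[+ _]; exact. Qed.

Lemma smooth_derive U f v : (forall k, Ck k U f) -> forall k, Ck k U ('D_v f).
Proof. by move=> Cf k; have [_] := Cf k.+1; exact. Qed.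

Lemma smooth_continuous U f x : (forall k, Ck k U f) -> U x -> {for x, continuous f}.
Proof. by move=> /(_ 0%N); exact. Qed.

End Smooth.

Section LinearImage.
Context (R : realType) (V W W' : normedModType R).

Lemma is_derive_linear (phi : W -> W') (G : V -> W) x v dG :
  linear phi -> continuous phi -> is_derive x v G dG ->
  is_derive x v (fun y => phi (G y)) (phi dG).
Proof.
move=> lphi cphi [dv <-].
have phi0 : phi 0 = 0.
  by have := lphi (- 1) 0 0; rewrite scaleN1r oppr0 addr0 scaleN1r addNr.
have phiB a b : phi (a - b) = phi a - phi b.
  by rewrite addrC -scaleN1r lphi scaleN1r addrC.
have phiZ r a : phi (r *: a) = r *: phi a by rewrite -[_ *: a]addr0 lphi phi0 addr0.
have C : (fun h : R => h^-1 *: (((fun y => phi (G y)) \o shift x) (h *: v) - phi (G x)))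
    @ 0^' --> phi ('D_v G x).
  have := cvg_comp _ _ dv (cphi ('D_v G x)).
  by apply: cvg_trans; apply: near_eq_cvg; near=> h; rewrite /= phiZ phiB.
by split; [apply/cvg_ex; eexists; exact: C|apply/cvg_lim => //; exact: C].
Unshelve. all: by end_near. Qed.

End LinearImage.

Section Coordinates.
Context (R : realType) (n : nat).

Lemma fst_coord_continuous i : continuous (fun z : 'rV[R]_n * 'rV[R]_n => z.1 0 i).
Proof.
move=> z; apply: (cvg_comp fst (fun x : 'rV[R]_n => x 0 i)); first exact: cvg_fst.
exact: coord_continuous.
Qed.

Lemma snd_coord_continuous i : continuous (fun z : 'rV[R]_n * 'rV[R]_n => z.2 0 i).
Proof.
move=> z; apply: (cvg_comp snd (fun x : 'rV[R]_n => x 0 i)); first exact: cvg_snd.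
exact: coord_continuous.
Qed.

Section Derivative.
Context (V : normedModType R) (G : V -> 'rV[R]_n * 'rV[R]_n) (x v : V).
Hypothesis dG : differentiable G x.

Let derG : is_derive x v G ('D_v G x).
Proof. by split=> //; exact: diff_derivable. Qed.

Lemma is_derive_fst : is_derive x v (fun y => (G y).1) ('D_v G x).1.
Proof. by apply: (is_derive_linear (phi := fst)) derG => // z; exact: cvg_fst. Qed.

Lemma is_derive_snd : is_derive x v (fun y => (G y).2) ('D_v G x).2.
Proof. by apply: (is_derive_linear (phi := snd)) derG => // z; exact: cvg_snd. Qed.

Lemma is_derive_fst_coord i : is_derive x v (fun y => (G y).1 0 i) (('D_v G x).1 0 i).
Proof.
have lin : linear (fun z : 'rV[R]_n * 'rV[R]_n => z.1 0 i : R^o).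
  by move=> r a b; rewrite !mxE.
apply: (is_derive_linear lin _ derG).
exact: fst_coord_continuous.
Qed.

Lemma is_derive_snd_coord i : is_derive x v (fun y => (G y).2 0 i) (('D_v G x).2 0 i).
Proof.
have lin : linear (fun z : 'rV[R]_n * 'rV[R]_n => z.2 0 i : R^o).
  by move=> r a b; rewrite !mxE.
apply: (is_derive_linear lin _ derG).
exact: snd_coord_continuous.
Qed.

End Derivative.

Local Notation phase := ('rV[R]_n * 'rV[R]_n * R)%type.

Definition partial_x (K : phase -> R) i := 'D_((@unit_vec R n i, 0), 0) K.
Definition partial_xi (K : phase -> R) i := 'D_((0, @unit_vec R n i), 0) K.
Definition partial_s (K : phase -> R) := 'D_((0, 0), 1) K.

(** Every tangent vector of phase space x parameter is a combination of the coordinate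
    vectors, on which the differential is a partial derivative. *)
Lemma diff_partials (K : phase -> R) y (w : phase) : differentiable K y ->
  'd K y w = \sum_(i < n) w.1.1 0 i * partial_x K i y
    + \sum_(i < n) w.1.2 0 i * partial_xi K i y + w.2 * partial_s K y.
Proof.
move=> dK.
have wE : w = \sum_(i < n) w.1.1 0 i *: ((@unit_vec R n i, 0), 0)
    + \sum_(i < n) w.1.2 0 i *: ((0, @unit_vec R n i), 0) + w.2 *: ((0, 0), 1).
  have -> : w.2 *: ((0, 0), 1) = ((0, 0), w.2) :> phase.
    by congr (_, _, _); rewrite ?scaler0// [_%:A]mulr1.
  have -> : \sum_(i < n) w.1.1 0 i *: ((@unit_vec R n i, 0), 0) = ((w.1.1, 0), 0) :> phase.
    rewrite [in RHS](row_sum_delta w.1.1).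
    rewrite (big_morph (fun a => (a, 0, 0) : phase) (id1 := 0) (op1 := +%R))//.
      by apply: eq_bigr => i _; congr (_, _, _); rewrite scaler0.
    by move=> a b; congr (_, _, _); rewrite addr0.
  have -> : \sum_(i < n) w.1.2 0 i *: ((0, @unit_vec R n i), 0) = ((0, w.1.2), 0) :> phase.
    rewrite [in RHS](row_sum_delta w.1.2).
    rewrite (big_morph (fun a => (0, a, 0) : phase) (id1 := 0) (op1 := +%R))//.
      by apply: eq_bigr => i _; congr (_, _, _); rewrite scaler0.
    by move=> a b; congr (_, _, _); rewrite addr0.
  case: w => -[a b] c /=.
  by congr (_, _, _); rewrite /= ?addr0 ?add0r.
rewrite {1}wE !linearD/= !linear_sum linearZ/=.
rewrite /partial_x /partial_xi /partial_s.
by congr (_ + _ + _); [apply: eq_bigr => i _..|]; rewrite ?linearZ/= deriveE.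
Qed.

Lemma is_derive_chain (V : normedModType R) (G : V -> 'rV[R]_n * 'rV[R]_n)
    (S : V -> R) (K : phase -> R) x v dS :
  differentiable G x -> differentiable S x -> differentiable K (G x, S x) ->
  is_derive x v S dS ->
  is_derive x v (fun y => K (G y, S y))
    (\sum_(i < n) ('D_v G x).1 0 i * partial_x K i (G x, S x)
    + \sum_(i < n) ('D_v G x).2 0 i * partial_xi K i (G x, S x)
    + dS * partial_s K (G x, S x)).
Proof.
move=> dG dS' dK [_ <-].
have dGS : differentiable (fun y => (G y, S y)) x by exact: differentiable_pair.
have dc : differentiable (K \o (fun y => (G y, S y))) x by exact: differentiable_comp.
split; first exact: diff_derivable.
rewrite deriveE// diff_comp//= diff_partials// diff_pair//= -!deriveE//.
Qed.

End Coordinates.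

(** * Smooth extensions of a curve family and of a Hamiltonian in a chart *)

(** Being nonzero is stated in some chart; the transformation law carries a zero
    from one chart to all the others. *)
Lemma covec_neq0 (R : realType) (n : nat) (M : manifold R n) (z : cotangent M) c :
  cotangent_nonzero z -> chart_dom c (base_pt z) -> covec z c <> 0.
Proof.
move=> [d zd] zc z0; apply: zd.
have [dz|dz] := pselect (chart_dom d (base_pt z)); last exact: covec_out.
by rewrite (covec_law dz zc) z0 mul0mx.
Qed.

Section LocalModel.
Context (R : realType) (n : nat) (M : manifold R n) (e : R).
Context (H : cotangent M -> R -> R) (g : R -> R -> cotangent M).

(** The condition that the chart c and the maps extending the curves (G, on U) and the
    Hamiltonian (K, on V) can be used at the point u = (t, s).  Both (G u, 0) and
    (G u, s) must lie in V: the energy is computed with the Hamiltonian of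
    parameter 0, the equations of motion with that of parameter s. *)
Definition model_at (c : chart M) (U : set (R * R))
    (G : R * R -> 'rV[R]_n * 'rV[R]_n) (V : set ('rV[R]_n * 'rV[R]_n * R))
    (u : R * R) : Prop :=
  [/\ U u, V (G u, 0), V (G u, u.2), `|u.2| < e &
    0 <= u.1 <= 1 -> chart_dom c (base_pt (g u.1 u.2)) /\
       G u = (curve_x g c u.1 u.2, curve_xi g c u.1 u.2)].

(** Open sets and smooth maps near (t0, 0) to which the calculus of several variables
    applies, although the curves live on a closed time interval and the chart of
    the manifold may take its values in a half-space. *)
Record local_model (c : chart M) (t0 : R) (U : set (R * R))
    (G : R * R -> 'rV[R]_n * 'rV[R]_n) (V : set ('rV[R]_n * 'rV[R]_n * R))
    (K : 'rV[R]_n * 'rV[R]_n * R -> R) : Prop := LocalModel {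
  model_openV : open V;
  model_smooth_curve : forall k, Ck k U G;
  model_smooth_ham : forall k, Ck k V K;
  model_ham : forall x xi s, V (x, xi, s) -> chart_img c x -> xi <> 0 ->
    `|s| < e -> local_rep H c x xi s = K (x, xi, s);
  model_near : \forall u \near (t0, 0 : R), model_at c U G V u
}.

(** A model at one time is a model at all nearby times, so that what is proved at
    the time t0 of a model holds near that time. *)
Lemma local_model_near c t0 U G V K : local_model c t0 U G V K ->
  \forall t \near t0, local_model c t U G V K.
Proof.
case=> oV GC KC KE nm.
have nn : \forall u \near (t0, 0 : R), \forall u' \near u, model_at c U G V u'.
  exact: nbhs_interior nm.
have : \forall t \near t0, \forall u' \near (t, 0 : R), model_at c U G V u'.
  exact: (slice1_cvg nn).
by apply: filterS => t.
Qed.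

Hypothesis he : 0 < e.
Hypothesis hH : hamiltonian_family e H.
Hypothesis hg : smooth_curve_family e g.

Lemma local_model_exists c t0 : 0 <= t0 <= 1 -> chart_dom c (base_pt (g t0 0)) ->
  exists U G V K, local_model c t0 U G V K.
Proof.
move=> t01 ct0.
have dom0 : curve_domain e (t0, 0) by split; rewrite //= normr0.
have [U [G [oU Ut GC GE]]] := curve_smooth hg (conj dom0 ct0).
have Gt0 := GE (t0, 0) (conj dom0 ct0) Ut.
have [V [K [oV Vt KC KE]]] : exists V K, [/\ open V, V (G (t0, 0), 0),
    forall k, Ck k V K & forall y, [/\ chart_img c y.1.1, y.1.2 <> 0 & `|y.2| < e] ->
      V y -> K y = local_rep H c y.1.1 y.1.2 y.2].
  apply: (@ham_smooth _ _ _ _ _ hH c); rewrite Gt0; split=> //=.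
  - by exists (base_pt (g t0 0)).
  - by apply: covec_neq0 => //; exact: (curve_nonzero hg).
  - by rewrite normr0.
exists U, G, V, K; split => //.
  by move=> x xi s Vx cx xi0 se; rewrite -(KE (x, xi, s)).
have cG : {for (t0, 0), continuous G} by exact: smooth_continuous GC Ut.
have nU : \forall u \near (t0, 0 : R), U u by exact: open_nbhs_nbhs.
have nV : \forall y \near (G (t0, 0), 0 : R), V y by exact: open_nbhs_nbhs.
have ne : \forall u \near (t0, 0 : R), `|u.2| < e.
  have : (snd : R * R -> R) @ (t0, 0 : R) --> (0 : R) by exact: cvg_snd.
  move=> /cvgr0_norm_lt/(_ _ he); exact.
have nV0 : \forall u \near (t0, 0 : R), V (G u, 0).
  have : (fun u => (G u, 0 : R)) @ (t0, 0 : R) --> (G (t0, 0), 0 : R).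
    by apply: cvg_prod; [exact: cG|exact: cvg_cst].
  by move=> /(_ _ nV).
have nVs : \forall u \near (t0, 0 : R), V (G u, u.2).
  have : (fun u => (G u, u.2 : R)) @ (t0, 0 : R) --> (G (t0, 0), 0 : R).
    by apply: cvg_prod; [exact: cG|exact: cvg_snd].
  by move=> /(_ _ nV).
have nc : \forall u \near (t0, 0 : R), curve_domain e u -> chart_dom c (base_pt (g u.1 u.2)).
  have /subspace_continuousP/(_ _ dom0) := curve_cont hg.
  have nc : nbhs (base_pt (g t0 0)) (chart_dom c).
    by apply: open_nbhs_nbhs; split => //; exact: chart_dom_open.
  by move=> /(_ _ nc).
near=> u.
have ue : `|u.2| < e by near: u.
have Uu : U u by near: u.
split => //; [by near: u..|move=> u01].
have du : curve_domain e u by [].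
have cu : chart_dom c (base_pt (g u.1 u.2)) by move: du; near: u.
by split => //; rewrite GE.
Unshelve. all: by end_near. Qed.

End LocalModel.

(** * The Hamiltonian in a local model *)

Section Hamiltonian.
Context (R : realType) (n : nat) (M : manifold R n) (e : R).
Context (H : cotangent M -> R -> R) (g : R -> R -> cotangent M).
Hypothesis hH : hamiltonian_family e H.

Variables (c : chart M) (t0 : R) (U : set (R * R)).
Variables (G : R * R -> 'rV[R]_n * 'rV[R]_n) (V : set ('rV[R]_n * 'rV[R]_n * R)).
Variable (K : 'rV[R]_n * 'rV[R]_n * R -> R).
Hypothesis model : local_model e H g c t0 U G V K.

Let smoothK := model_smooth_ham model.
Let diffK y : V y -> differentiable K y.
Proof. exact: smooth_differentiable smoothK. Qed.

Lemma model_value z s : cotangent_nonzero z -> chart_dom c (base_pt z) -> `|s| < e ->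
  V (chart_map c (base_pt z), covec z c, s) ->
  H z s = K (chart_map c (base_pt z), covec z c, s).
Proof.
move=> z0 cz se Vz; rewrite -(model_ham model)// ?local_repE//.
  by exists (base_pt z).
exact: covec_neq0.
Qed.

Lemma cotangent_scale_nonzero (a : R) (z : cotangent M) : a != 0 ->
  cotangent_nonzero z -> cotangent_nonzero (cotangent_scale a z).
Proof. by move=> a0 [d zd]; exists d => /= /eqP; rewrite scaler_eq0 (negPf a0) => /eqP. Qed.

(** Euler's identity: both sides are derivatives at r = 1 of K(x, r xi, s), which is
    r^2 K(x, xi, s) by homogeneity. *)
Lemma model_euler z s : cotangent_nonzero z -> chart_dom c (base_pt z) -> `|s| < e ->
  V (chart_map c (base_pt z), covec z c, s) ->
  \sum_(i < n) covec z c 0 i * partial_xi K i (chart_map c (base_pt z), covec z c, s) =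
  2 * K (chart_map c (base_pt z), covec z c, s).
Proof.
move=> z0 cz se; set x := chart_map _ _; set xi := covec z c => Vz.
(* The curve r |-> (x, r xi, s) is the line a + r v. *)
pose a : 'rV[R]_n * 'rV[R]_n * R := (x, 0, s).
pose v : 'rV[R]_n * 'rV[R]_n * R := (0, xi, 0).
have avE r : a + r *: v = (x, r *: xi, s).
  by rewrite /a /v; congr (_, _, _); rewrite /= ?scaler0 ?addr0 ?add0r.
have dl : is_derive (1 : R) 1 (fun r => K (a + r *: v)) ('D_v K (a + 1 *: v)).
  apply: is_derive_line; split => //; apply: diff_derivable.
  by rewrite avE scale1r; exact: diffK.
have nV : \forall r \near (1 : R), V (a + r *: v).
  have : (fun r : R => a + r *: v) @ (1 : R) --> a + 1 *: v.
    apply: cvgD; first exact: cvg_cst.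
    by apply: cvgZr_tmp; exact: cvg_id.
  apply; apply: open_nbhs_nbhs; split; first exact: model_openV model.
  by rewrite avE scale1r.
have dr : is_derive (1 : R) 1 (fun r => K (a + r *: v)) (2 * K (x, xi, s)).
  apply: (@near_eq_is_derive _ R R (fun r => r ^+ 2 * K (x, xi, s))).
    near=> r.
    have r0 : 0 < r by near: r; exact: lt_nbhsr.
    have Vr : V (x, r *: xi, s) by rewrite -avE; near: r.
    rewrite avE -(model_value z0)// -(ham_homog hH)//.
    by rewrite (model_value (cotangent_scale_nonzero _ z0))//= gt_eqF.
  have -> : (fun r : R => r ^+ 2 * K (x, xi, s)) = K (x, xi, s) *: (id : R -> R) ^+ 2.
    by apply/funext => r; rewrite mulrC.
  apply: is_derive_eq; rewrite /= expr1n !scaler1 -mulr_natl mulr1 /GRing.scale/=.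
  by rewrite mulrC.
have := @derive_val _ _ _ _ _ _ _ dl; rewrite (@derive_val _ _ _ _ _ _ _ dr).
rewrite avE scale1r deriveE; last exact: diffK.
rewrite diff_partials; last exact: diffK.
rewrite mul0r addr0 [X in X + _]big1 ?add0r// => i _.
by rewrite mxE mul0r.
Unshelve. all: by end_near. Qed.

Lemma model_H_xi x xi s i : V (x, xi, s) -> chart_img c x -> xi <> 0 -> `|s| < e ->
  H_xi H c x xi s 0 i = partial_xi K i (x, xi, s).
Proof.
move=> Vx cx xi0 se; rewrite mxE.
have cE : (fun eta => (x, eta, s)) @ xi --> (x, xi, s).
  by apply: (cvg_prod (F := nbhs xi)); [exact: slice2_cvg|exact: cvg_cst].
have nV : \forall eta \near xi, V (x, eta, s).
  have nVy : nbhs (x, xi, s) V.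
    by apply: open_nbhs_nbhs; split => //; exact: model_openV model.
  by have := cE _ nVy.
have n0 : \forall eta \near xi, eta <> 0.
  have /eqP xi_neq0 := xi0.
  by near=> eta; apply/eqP; near: eta; apply: (cvgr_neq0 xi) => //; exact: cvg_id.
rewrite (@near_eq_derive _ _ _ _ (fun eta => K (x, eta, s))); last first.
  near=> eta; apply: (model_ham model) => //; near: eta.
    exact: nV.
  exact: n0.
apply: (derive_reparam K (j := fun eta => (x, eta, s))) => h /=.
by rewrite -[RHS]/(h *: 0 + x, h *: @unit_vec R n i + xi, h *: (0 : R) + s) !scaler0 !add0r.
Unshelve. all: by end_near. Qed.

(** [H_x] is a derivative within the image of the chart; on the boundary it is one-sided
    in the last coordinate, and still agrees with the partial derivative of the
    extension K because x + h e_i stays in the half-space for small h > 0. *)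
Lemma model_H_x x xi s i : V (x, xi, s) -> chart_img c x -> xi <> 0 -> `|s| < e ->
  H_x H c x xi s 0 i = partial_x K i (x, xi, s).
Proof.
move=> Vx [p cp px] xi0 se; rewrite mxE.
have cE : (fun y => (y, xi, s)) @ x --> (x, xi, s).
  by apply: (cvg_prod (F := nbhs x)); [exact: slice1_cvg|exact: cvg_cst].
have nV : \forall y \near x, V (y, xi, s).
  have nVy : nbhs (x, xi, s) V.
    by apply: open_nbhs_nbhs; split => //; exact: model_openV model.
  by have := cE _ nVy.
have dK : differentiable (fun y => K (y, xi, s)) x.
  apply: (@differentiable_comp _ _ _ _ (fun y => (y, xi, s)) K); last exact: diffK.
  by apply: differentiable_pair => //; apply: differentiable_pair.
have PF : ProperFilter (within [set h : R | chart_img c (x + h *: @unit_vec R n i)] 0^').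
  apply: half_proper; last by rewrite -px; exact: in_half.
  by have := near_img cp openT I; rewrite px setIT; exact.
have nE : \forall y \near x, chart_img c y -> local_rep H c y xi s = K (y, xi, s).
  by near=> y => cy; apply: (model_ham model) => //; near: y.
rewrite (derive_inE PF dK nE); last by exists p.
rewrite -deriveE//; apply: (derive_reparam K (j := fun y => (y, xi, s))) => h /=.
by rewrite -[RHS]/(h *: @unit_vec R n i + x, h *: 0 + xi, h *: (0 : R) + s) !scaler0 !add0r.
Unshelve. all: by end_near. Qed.

End Hamiltonian.

(** * The energy identity at one time *)

Lemma derive_in_interior (R : realType) (W : normedModType R) (f G : R -> W) (t : R) dG :
  0 < t < 1 -> is_derive t 1 G dG ->
  (\forall t' \near t, 0 <= t' <= 1 -> f t' = G t') ->
  derive_in (`[0, 1] : set R) f t 1 = dG.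
Proof.
move=> t01 [dvG <-] fG.
have nt : \forall t' \near t, (`[0, 1]%classic : set R) t'.
  have : \forall t' \near t, (`]0, 1[%classic : set R) t'.
    by apply: near_in_itvoo; rewrite inE.
  by apply: filterS => t'; apply: subset_itv_oo_cc.
have PF : ProperFilter (within [set h : R | (`[0, 1]%classic : set R) (t + h *: 1)] 0^').
  apply: Build_ProperFilter_ex => /= B; rewrite /within/= => HB.
  have nh : \forall h \near (0 : R)^', (`[0, 1]%classic : set R) (t + h *: 1).
    have /= K := @line_cvg R R t 1 _ nt; exact: K.
  by apply: (@filter_ex _ (0 : R)^'); near=> h; apply: (near HB h) => //; near: h.
have dfG : differentiable G t by exact/derivable1_diffP.
have nE : \forall t' \near t, (`[0, 1]%classic : set R) t' -> f t' = G t'.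
  by near=> t'; rewrite /= in_itv/=; apply: (near fG t').
by rewrite (derive_inE PF dfG nE) -?deriveE//; exact: nbhs_singleton nt.
Unshelve. all: by end_near. Qed.

(** The elimination that produces the energy identity, in coordinates.  The families
    stand for xi, x_s, xi_s, x_t, xi_t, x_ts, x_st, H_x, H_xi, and ks for H_s. *)
Lemma balance_of_sums (R : realType) n (xi xs xis xt xit xts xst kx kxi : 'I_n -> R) (ks : R) :
  (forall i, xt i = kxi i) -> (forall i, xit i = - kx i) ->
  (forall i, xts i = xst i) ->
  \sum_(i < n) (xis i * xt i + xi i * xts i) =
    2 * (\sum_(i < n) xs i * kx i + \sum_(i < n) xis i * kxi i + ks) ->
  \sum_(i < n) (xit i * xs i + xi i * xst i) =
    \sum_(i < n) xs i * kx i + \sum_(i < n) xis i * kxi i + 2 * ks.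
Proof.
move=> xtE xitE xtsE; rewrite !big_split/=.
have -> : \sum_(i < n) xi i * xts i = \sum_(i < n) xi i * xst i.
  by apply: eq_bigr => i _; rewrite xtsE.
have -> : \sum_(i < n) xis i * xt i = \sum_(i < n) xis i * kxi i.
  by apply: eq_bigr => i _; rewrite xtE.
have -> : \sum_(i < n) xit i * xs i = - \sum_(i < n) xs i * kx i.
  by rewrite -sumrN; apply: eq_bigr => i _; rewrite xitE mulNr mulrC.
lra.
Qed.

Section Curve.
Context (R : realType) (n : nat) (M : manifold R n) (e : R).
Context (H : cotangent M -> R -> R) (g : R -> R -> cotangent M).
Hypothesis he : 0 < e.
Hypothesis hH : hamiltonian_family e H.
Hypothesis hg : smooth_curve_family e g.
Hypothesis hcurve : forall s : R, `|s| < e -> hamiltonian_curve H s g.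

Section AtTime.
Variables (c : chart M) (t0 : R) (U : set (R * R)).
Variables (G : R * R -> 'rV[R]_n * 'rV[R]_n) (V : set ('rV[R]_n * 'rV[R]_n * R)).
Variable (K : 'rV[R]_n * 'rV[R]_n * R -> R).
Hypothesis model : local_model e H g c t0 U G V K.

Let p0 : R * R := (t0, 0).
Let Dt : R * R := (1, 0).
Let Ds : R * R := (0, 1).

Let smoothG : forall k, Ck k U G := model_smooth_curve model.
Let smoothK : forall k, Ck k V K := model_smooth_ham model.

Let diffG u : U u -> differentiable G u.
Proof. exact: smooth_differentiable. Qed.

Let diffDG w u : U u -> differentiable ('D_w G) u.
Proof. exact: smooth_differentiable (smooth_derive w smoothG). Qed.

Let contDDG w w' u : U u -> {for u, continuous ('D_w' ('D_w G))}.
Proof. by move=> Uu; exact: smooth_continuous (smooth_derive w' (smooth_derive w smoothG)) Uu. Qed.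

Let diffK y : V y -> differentiable K y.
Proof. exact: smooth_differentiable. Qed.

Let near_model : \forall u \near p0, model_at e g c U G V u := model_near model.

Let near_U : \forall u \near p0, U u.
Proof. by apply: filterS near_model => u []. Qed.

Let Up0 : U p0.
Proof. exact: nbhs_singleton near_U. Qed.

Let Vp0 : V (G p0, 0).
Proof. by have [] := nbhs_singleton near_model. Qed.

(** The s-derivative of H(x, xi; 0) along the curves, at u = (t, s). *)
Definition energy_rate (u : R * R) : R :=
  \sum_(i < n) ('D_Ds G u).1 0 i * partial_x K i (G u, 0)
  + \sum_(i < n) ('D_Ds G u).2 0 i * partial_xi K i (G u, 0).

(** The pairing of xi with the derivative of x in the direction w: the quantity
    <xi, x_t> for w = Dt and <xi, x_s> for w = Ds. *)
Definition pairing_along (w u : R * R) : R :=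
  \sum_(i < n) (G u).2 0 i * ('D_w G u).1 0 i.

Lemma is_derive_unperturbed_energy u : U u -> V (G u, 0) ->
  is_derive u Ds (fun u => K (G u, 0)) (energy_rate u).
Proof.
move=> Uu Vu; apply: is_derive_eq.
  exact: (is_derive_chain (S := cst 0)) (diffG _) _ (diffK _) _.
by rewrite mul0r addr0.
Qed.

Lemma is_derive_pairing_along w w' u : U u ->
  is_derive u w' (pairing_along w)
   (\sum_(i < n) (('D_w' G u).2 0 i * ('D_w G u).1 0 i
                 + (G u).2 0 i * ('D_w' ('D_w G) u).1 0 i)).
Proof.
move=> Uu; rewrite /pairing_along.
apply: is_derive_sum_fun => i; apply: is_derive_product.
  by apply: is_derive_snd_coord; exact: diffG.
by apply: is_derive_fst_coord; exact: diffDG.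
Qed.

Lemma mixed_partials i :
  ('D_Ds ('D_Dt G) p0).1 0 i = ('D_Dt ('D_Ds G) p0).1 0 i.
Proof.
apply: (mixed_derive_eq (f := fun u => (G u).1 0 i) (a := p0) (u := Dt) (v := Ds)
   (fu := fun u => ('D_Dt G u).1 0 i) (fv := fun u => ('D_Ds G u).1 0 i)
   (fuv := fun u => ('D_Ds ('D_Dt G) u).1 0 i)
   (fvu := fun u => ('D_Dt ('D_Ds G) u).1 0 i)).
- by apply: filterS near_U => u Uu; apply: is_derive_fst_coord; exact: diffG.
- by apply: filterS near_U => u Uu; apply: is_derive_fst_coord; exact: diffG.
- by apply: filterS near_U => u Uu; apply: is_derive_fst_coord; exact: diffDG.
- by apply: filterS near_U => u Uu; apply: is_derive_fst_coord; exact: diffDG.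
- apply: (cvg_comp ('D_Ds ('D_Dt G)) (fun z => z.1 0 i)); first exact: contDDG.
  exact: fst_coord_continuous.
- apply: (cvg_comp ('D_Dt ('D_Ds G)) (fun z => z.1 0 i)); first exact: contDDG.
  exact: fst_coord_continuous.
Qed.

Lemma continuous_unperturbed_energy u : U u -> V (G u, 0) ->
  {for u, continuous (fun u => K (G u, 0))}.
Proof.
move=> Uu Vu; apply: (cvg_comp (fun u => (G u, 0)) K).
  apply: (cvg_prod (F := nbhs u)); last exact: cvg_cst.
  exact: smooth_continuous smoothG Uu.
exact: smooth_continuous smoothK Vu.
Qed.

Lemma continuous_energy_rate u : U u -> V (G u, 0) -> {for u, continuous energy_rate}.
Proof.
move=> Uu Vu.
have cDG w : {for u, continuous ('D_w G)}.
  exact: smooth_continuous (smooth_derive w smoothG) Uu.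
have cDK w : {for u, continuous (fun u => 'D_w K (G u, 0))}.
  apply: (cvg_comp (fun u => (G u, 0)) ('D_w K)).
    apply: (cvg_prod (F := nbhs u)); last exact: cvg_cst.
    exact: smooth_continuous smoothG Uu.
  exact: smooth_continuous (smooth_derive w smoothK) Vu.
apply: cvgD; (apply: cvg_big => [|i _]; first exact: add_continuous); apply: cvgM; try exact: cDK.
- apply: (cvg_comp ('D_Ds G) (fun z => z.1 0 i)); first exact: cDG.
  exact: fst_coord_continuous.
- apply: (cvg_comp ('D_Ds G) (fun z => z.2 0 i)); first exact: cDG.
  exact: snd_coord_continuous.
Qed.

Lemma near_interior : 0 < t0 < 1 -> \forall u \near p0, 0 < u.1 < 1.
Proof.
move=> /andP[t00 t01].
have nt : \forall t \near t0, 0 < t < 1.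
  by near=> t; apply/andP; split; near: t; [exact: lt_nbhsr|exact: lt_nbhsl].
have fstE : fst @ p0 --> t0 by exact: cvg_fst.
exact: (fstE _ nt).
Unshelve. all: by end_near. Qed.

(** Hamilton's equations for the extension G.  At interior times the one-sided
    derivatives in the definition of a Hamiltonian curve are derivatives, and they
    only see values of the curve that G reproduces.  The relation is needed on a
    neighbourhood of (t0, 0), since its first half gets differentiated in s. *)
Lemma curve_velocity : 0 < t0 < 1 -> \forall u \near p0,
  ('D_Dt G u).1 = H_xi H c (G u).1 (G u).2 u.2 /\
  ('D_Dt G u).2 = - H_x H c (G u).1 (G u).2 u.2.
Proof.
move=> /andP[t00 t01].
have nt := near_interior (introT andP (conj t00 t01)).
have nn : \forall u \near p0, \forall u' \near u, model_at e g c U G V u'.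
  exact: nbhs_interior near_model.
near=> u.
have ut : 0 < u.1 < 1 by near: u.
have /andP[/ltW ut0 /ltW ut1] := ut.
have nu : \forall u' \near u, model_at e g c U G V u' by near: u.
have [Uu _ _ ue /(_ _)[|cu Gu]] := nbhs_singleton nu; first by rewrite ut0.
rewrite Gu /=.
have [<- <-] : derive_in (`[0, 1] : set R) (fun t' => curve_x g c t' u.2) u.1 1 =
      H_xi H c (curve_x g c u.1 u.2) (curve_xi g c u.1 u.2) u.2 /\
    derive_in (`[0, 1] : set R) (fun t' => curve_xi g c t' u.2) u.1 1 =
      - H_x H c (curve_x g c u.1 u.2) (curve_xi g c u.1 u.2) u.2.
  by apply: hcurve => //; rewrite ut0.
have dG := diffG Uu.
have slice : \forall t' \near u.1, 0 <= t' <= 1 ->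
    G (t', u.2) = (curve_x g c t' u.2, curve_xi g c t' u.2).
  have nu' : \forall u' \near (u.1, u.2), model_at e g c U G V u'.
    by rewrite -surjective_pairing.
  have : \forall t' \near u.1, model_at e g c U G V (t', u.2) by exact: (slice1_cvg nu').
  by apply: filterS => t' [_ _ _ _ /=] Gt' /Gt'[].
have uE : u = (u.1, u.2) by exact: surjective_pairing.
split; apply/esym.
  apply: (derive_in_interior (G := fun t' => (G (t', u.2)).1) ut).
    by apply: (is_derive_slice1 (F := fun u' => (G u').1)); rewrite -uE; exact: is_derive_fst.
  by apply: filterS slice => t' /[apply] ->.
apply: (derive_in_interior (G := fun t' => (G (t', u.2)).2) ut).
  by apply: (is_derive_slice1 (F := fun u' => (G u').2)); rewrite -uE; exact: is_derive_snd.
by apply: filterS slice => t' /[apply] ->.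
Unshelve. all: by end_near. Qed.

Lemma model_point u : model_at e g c U G V u -> 0 <= u.1 <= 1 ->
  [/\ chart_img c (G u).1, (G u).2 <> 0, cotangent_nonzero (g u.1 u.2),
    chart_dom c (base_pt (g u.1 u.2)) &
    G u = (chart_map c (base_pt (g u.1 u.2)), covec (g u.1 u.2) c)].
Proof.
move=> [_ _ _ ue cG] u01; have [cu Gu] := cG u01.
have nz : cotangent_nonzero (g u.1 u.2) by apply: (curve_nonzero hg).
rewrite Gu; split => //; first by exists (base_pt (g u.1 u.2)).
exact: covec_neq0.
Qed.

(** Since x_t = H_xi, this is Euler's identity along the curves. *)
Lemma pairing_along_energy : 0 < t0 < 1 ->
  \forall u \near p0, pairing_along Dt u = 2 * K (G u, u.2).
Proof.
move=> t01; have vel := curve_velocity t01.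
have nt := near_interior t01.
near=> u.
have /andP[/ltW ut0 /ltW ut1] : 0 < u.1 < 1 by near: u.
have u01 : 0 <= u.1 <= 1 by rewrite ut0.
have mu : model_at e g c U G V u by near: u.
have [cx xi0 nz cu Gu] := model_point mu u01.
have [_ _ Vu ue _] := mu.
have [velx _] : ('D_Dt G u).1 = H_xi H c (G u).1 (G u).2 u.2 /\
  ('D_Dt G u).2 = - H_x H c (G u).1 (G u).2 u.2 by near: u.
have pairE : (G u, u.2) = ((G u).1, (G u).2, u.2) by rewrite -surjective_pairing.
have [xE xiE] : chart_map c (base_pt (g u.1 u.2)) = (G u).1 /\
  covec (g u.1 u.2) c = (G u).2 by rewrite Gu.
have := model_euler hH model nz cu ue.
rewrite xE xiE -pairE => /(_ Vu) <-; apply: eq_bigr => i _.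
by rewrite velx (model_H_xi model)// -pairE.
Unshelve. all: by end_near. Qed.

(** At s = 0, d/dt <xi, x_s> = d/ds H(x, xi; 0) + 2 H_s: the s-derivative of
    <xi, x_t> = 2 H(x, xi; s), combined with Hamilton's equations and x_ts = x_st. *)
Lemma energy_identity : 0 < t0 < 1 ->
  is_derive t0 1 (fun t => pairing_along Ds (t, 0))
    (energy_rate p0 + 2 * partial_s K (G p0, 0)).
Proof.
move=> t01.
have t01' : 0 <= t0 <= 1 by move/andP: t01 => [/ltW-> /ltW->].
have [cx xi0 _ _ _] := model_point (nbhs_singleton near_model) t01'.
have [velx velxi] := nbhs_singleton (curve_velocity t01).
have xtE i : ('D_Dt G p0).1 0 i = partial_xi K i (G p0, 0).
  by rewrite velx (model_H_xi model)//= ?normr0// -surjective_pairing.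
have xitE i : ('D_Dt G p0).2 0 i = - partial_x K i (G p0, 0).
  by rewrite velxi mxE (model_H_x model)//= ?normr0// -surjective_pairing.
have dE : \sum_(i < n) (('D_Ds G p0).2 0 i * ('D_Dt G p0).1 0 i
                 + (G p0).2 0 i * ('D_Ds ('D_Dt G) p0).1 0 i) =
  2 * (energy_rate p0 + partial_s K (G p0, 0)).
  (* Two expressions of the s-derivative of <xi, x_t> = 2 H(x, xi; s). *)
  have d1 := is_derive_pairing_along Dt Ds Up0.
  have d2 : is_derive p0 Ds (pairing_along Dt) (2 * (energy_rate p0 + partial_s K (G p0, 0))).
    apply: (@near_eq_is_derive _ _ _ (fun u => 2 * K (G u, u.2))).
      by apply: filterS (pairing_along_energy t01) => u ->.
    apply: is_derive_scale.
    have dsnd : is_derive p0 Ds (snd : R * R -> R) 1.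
      by apply: (is_derive_linear (phi := snd) (G := id)) => // z; exact: cvg_snd.
    have dsnd' : differentiable (snd : R * R -> R) p0.
      by apply: linear_differentiable => x; exact: cvg_snd.
    have D := is_derive_chain (diffG Up0) dsnd' (diffK Vp0) dsnd.
    apply: (is_derive_eq D).
    by congr (_ + _); exact: mul1r.
  by rewrite -(@derive_val _ _ _ _ _ _ _ d1) -(@derive_val _ _ _ _ _ _ _ d2).
apply: (is_derive_eq (is_derive_slice1 (is_derive_pairing_along Ds Dt Up0))).
exact: (balance_of_sums xtE xitE mixed_partials dE).
Qed.

Lemma unperturbed_energy_model : \forall u \near p0, 0 <= u.1 <= 1 ->
  H (g u.1 u.2) 0 = K (G u, 0).
Proof.
apply: filterS near_model => u mu u01.
have [_ _ nz cu Gu] := model_point mu u01; have [_ Vu _ _ _] := mu.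
by rewrite Gu in Vu *; rewrite (model_value model) ?normr0.
Qed.

Hypothesis t01 : 0 <= t0 <= 1.

(** Only s varies here and in the identifications that follow, so t0 may be an end of
    the time interval. *)
Lemma derive1_unperturbed_energy :
  derive1 (fun s => H (g t0 s) 0) 0 = energy_rate p0.
Proof.
have D := is_derive_slice2 (is_derive_unperturbed_energy Up0 Vp0).
rewrite derive1E; apply: derive_val; apply: near_eq_is_derive D.
have : \forall s \near (0 : R), 0 <= t0 <= 1 -> H (g t0 s) 0 = K (G (t0, s), 0).
  exact: (slice2_cvg unperturbed_energy_model).
by apply: filterS => s /(_ t01).
Qed.

Lemma H_s_model : H_s H (g t0 0) 0 = partial_s K (G p0, 0).
Proof.
rewrite /H_s derive1E.
rewrite (@near_eq_derive _ _ _ _ (fun s => K (G p0, s))); last first.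
  have nV : \forall s \near (0 : R), V (G p0, s).
    have nVy : \forall y \near (G p0, 0 : R), V y.
      by apply: open_nbhs_nbhs; split => //; exact: model_openV model.
    exact: (slice2_cvg nVy).
  have ne : \forall s \near (0 : R), `|s| < e by exact: nbhs0_lt.
  near=> s.
  have se : `|s| < e by near: s.
  have Vs : V (G p0, s) by near: s.
  have [_ _ nz cu Gu] := model_point (nbhs_singleton near_model) t01.
  by rewrite Gu in Vs *; rewrite (model_value model).
apply: (derive_reparam K (j := fun s => (G p0, s))) => h /=.
by rewrite -[RHS]/(h *: 0 + G p0, h *: (1 : R) + 0) !scaler0 !add0r.
Unshelve. all: by end_near. Qed.

Lemma is_derive_curve_x : is_derive (0 : R) 1 (curve_x g c t0) ('D_Ds G p0).1.
Proof.
have D := is_derive_slice2 (is_derive_fst Ds (diffG Up0)).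
apply: near_eq_is_derive D.
have : \forall s \near (0 : R), model_at e g c U G V (t0, s).
  exact: (slice2_cvg near_model).
by apply: filterS => s [_ _ _ _ /(_ t01)[_ ->]].
Qed.

Lemma pairing_model : pairing_xs g c t0 0 = pairing_along Ds p0.
Proof.
rewrite /pairing_xs /curve_xs derive1E (@derive_val _ _ _ _ _ _ _ is_derive_curve_x).
have [_ _ nz cu Gu] := model_point (nbhs_singleton near_model) t01.
by apply: eq_bigr => i _; rewrite [in RHS]Gu.
Qed.

Lemma continuous_pairing_along : {for p0, continuous (pairing_along Ds)}.
Proof.
apply: cvg_big => [|i _]; first exact: add_continuous.
apply: cvgM.
  apply: (cvg_comp G (fun z => z.2 0 i)); first exact: smooth_continuous smoothG Up0.
  exact: snd_coord_continuous.
apply: (cvg_comp ('D_Ds G) (fun z => z.1 0 i)); last exact: fst_coord_continuous.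
exact: smooth_continuous (smooth_derive Ds smoothG) Up0.
Qed.

Lemma continuous_partial_s : {for p0, continuous (fun u => partial_s K (G u, 0))}.
Proof.
apply: (cvg_comp (fun u => (G u, 0)) (partial_s K)).
  apply: (cvg_prod (F := nbhs p0)); last exact: cvg_cst.
  exact: smooth_continuous smoothG Up0.
exact: smooth_continuous (smooth_derive _ smoothK) Vp0.
Qed.

End AtTime.

(** * Independence of the chart and integration *)

(** If J is the Jacobian matrix from c to d, the components of x_s in d are those in c
    times J, while the components of xi in c are those in d times the
    transpose of J; the two factors cancel in the pairing. *)
Lemma pairing_chart_indep c d t : 0 <= t <= 1 ->
  chart_dom c (base_pt (g t 0)) -> chart_dom d (base_pt (g t 0)) ->
  pairing_xs g c t 0 = pairing_xs g d t 0.
Proof.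
move=> t01 ct dt.
have [U [G [V [K model]]]] := local_model_exists he hH hg t01 ct.
have Dc := is_derive_curve_x model t01.
have [U' [G' [V' [K' model']]]] := local_model_exists he hH hg t01 dt.
have Dd := is_derive_curve_x model' t01.
have [T [dT TE JT]] := jacE ct dt.
set vc := ('D_ _ G _).1 in Dc; set vd := ('D_ _ G' _).1 in Dd.
have vE : vd = vc *m jac c d (base_pt (g t 0)).
  rewrite -JT -(@derive_val _ _ _ _ _ _ _ Dd).
  have [vx _] := Dc.
  have cx : {for 0, continuous (curve_x g c t)}.
    by apply: differentiable_continuous; exact/derivable1_diffP.
  apply: derive_val; apply: near_eq_is_derive (is_derive_diff_comp dT Dc).
  have near_c : \forall s \near (0 : R), chart_dom c (base_pt (g t s)).
    have : \forall s \near (0 : R), model_at e g c U G V (t, s).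
      exact: (slice2_cvg (model_near model)).
    by apply: filterS => s [_ _ _ _ /(_ t01)[]].
  have near_d : \forall s \near (0 : R), chart_dom d (base_pt (g t s)).
    have : \forall s \near (0 : R), model_at e g d U' G' V' (t, s).
      exact: (slice2_cvg (model_near model')).
    by apply: filterS => s [_ _ _ _ /(_ t01)[]].
  have near_T : \forall s \near (0 : R),
      (chart_map c @` (chart_dom c `&` chart_dom d)) (curve_x g c t s) ->
      chart_map d (chart_inv c (curve_x g c t s)) = T (curve_x g c t s).
    exact: (cx _ TE).
  near=> s.
  have cs : chart_dom c (base_pt (g t s)) by near: s.
  have ds : chart_dom d (base_pt (g t s)) by near: s.
  rewrite -(near near_T s)//; first by rewrite /curve_x chart_mapK.
  by exists (base_pt (g t s)).
rewrite /pairing_xs /curve_xs !derive1E.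
rewrite (@derive_val _ _ _ _ _ _ _ Dc) (@derive_val _ _ _ _ _ _ _ Dd).
transitivity ((curve_xi g c t 0 *m vc^T) 0 0).
  by rewrite mxE; apply: eq_bigr => i _; rewrite mxE.
rewrite /curve_xi (covec_law ct dt) -mulmxA -trmx_mul -vE.
by rewrite mxE; apply: eq_bigr => i _; rewrite mxE.
Unshelve. all: by end_near. Qed.

(** One chart around a time t serves all nearby times, which makes the three
    quantities of the energy identity continuous up to the ends of the interval. *)
Lemma local_energy_balance c t : 0 <= t <= 1 -> chart_dom c (base_pt (g t 0)) ->
  exists P rate S : R -> R,
  [/\ \forall t' \near t, 0 <= t' <= 1 ->
        [/\ chart_dom c (base_pt (g t' 0)), pairing_xs g c t' 0 = P t',
          derive1 (fun s => H (g t' s) 0) 0 = rate t' & H_s H (g t' 0) 0 = S t'],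
    [/\ {for t, continuous P}, {for t, continuous rate} & {for t, continuous S}] &
    0 < t < 1 -> is_derive t 1 P (rate t + 2 * S t)].
Proof.
move=> t01 ct.
have [U [G [V [K model]]]] := local_model_exists he hH hg t01 ct.
have [Uu Vu _ _ _] := nbhs_singleton (model_near model).
exists (fun t => pairing_along G (0, 1) (t, 0)), (fun t => energy_rate G K (t, 0)),
  (fun t => partial_s K (G (t, 0), 0)); split.
- apply: filterS (local_model_near model) => t' model' t'01; split.
  + by have [_ _ _ _ /(_ t'01)[]] := nbhs_singleton (model_near model').
  + exact: pairing_model model' t'01.
  + exact: derive1_unperturbed_energy model' t'01.
  + exact: H_s_model model' t'01.
- split.
  + exact: (@continuous_slice1 _ _ _ (pairing_along G (0, 1)) t 0 (continuous_pairing_along model)).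
  + exact: (@continuous_slice1 _ _ _ (energy_rate G K) t 0
      (continuous_energy_rate model Uu Vu)).
  + exact: (@continuous_slice1 _ _ _ (fun u => partial_s K (G u, 0)) t 0
      (continuous_partial_s model)).
- exact: energy_identity model.
Qed.

Lemma local_unperturbed_energy t : 0 <= t <= 1 -> exists F DF : R * R -> R,
    \forall u \near (t : R, 0 : R), [/\ is_derive u (0 : R, 1 : R) F (DF u),
      {for u, continuous F}, {for u, continuous DF} &
      0 <= u.1 <= 1 -> H (g u.1 u.2) 0 = F u].
Proof.
move=> t01; have [c ct] := chart_cover (base_pt (g t 0)).
have [U [G [V [K model]]]] := local_model_exists he hH hg t01 ct.
exists (fun u => K (G u, 0)), (energy_rate G K).
near=> u.
have [Uu Vu _ _ _] : model_at e g c U G V u by near: u; exact: model_near model.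
have FE : 0 <= u.1 <= 1 -> H (g u.1 u.2) 0 = K (G u, 0).
  by near: u; exact: unperturbed_energy_model model.
split => //.
- by have := is_derive_unperturbed_energy model Uu Vu; exact.
- by have := continuous_unperturbed_energy model Uu Vu; exact.
- by have := continuous_energy_rate model Uu Vu; exact.
Unshelve. all: by end_near. Qed.

End Curve.

Theorem lemma3p1 (R : realType) (n : nat) (hn : (2 <= n)%N) (M : manifold R n)
    (e : R) (he : 0 < e)
    (H : cotangent M -> R -> R) (hH : hamiltonian_family e H)
    (g : R -> R -> cotangent M) (hg : smooth_curve_family e g)
    (hcurve : forall s : R, `|s| < e -> hamiltonian_curve H s g)
    (c0 c1 : chart M)
    (hc0 : chart_dom c0 (base_pt (g 0 0))) (hc1 : chart_dom c1 (base_pt (g 1 0))) :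
  is_derive (0 : R) (1 : R) (energy H g)
    (pairing_xs g c1 1 0 - pairing_xs g c0 0 0
     - 2 * \int[lebesgue_measure]_(t in `[0, 1]) H_s H (g t 0) 0).
Proof.
have DE := is_derive_integral (f := fun t s => H (g t s) 0) (local_unperturbed_energy he hH hg).
apply: (is_derive_eq DE).
(* The charts are chosen time by time, without any coherence. *)
pose cc t := sval (cid (chart_cover (base_pt (g t 0)))).
have ccP t : chart_dom (cc t) (base_pt (g t 0)).
  exact: (svalP (cid (chart_cover (base_pt (g t 0))))).
have balance := @integral_rate_balance R 2 (fun t => pairing_xs g (cc t) t 0)
  (fun t => derive1 (fun s => H (g t s) 0) 0) (fun t => H_s H (g t 0) 0).
have z01 : 0 <= (0 : R) <= 1 by rewrite lexx ler01.
have i01 : 0 <= (1 : R) <= 1 by rewrite lexx ler01.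
have E1 := pairing_chart_indep he hH hg i01 (ccP 1) hc1.
have E0 := pairing_chart_indep he hH hg z01 (ccP 0) hc0.
rewrite E0 E1 in balance.
apply: balance => t t01.
have [P [rate [S [nE cE dE]]]] := local_energy_balance he hH hg hcurve t01 (ccP t).
exists P, rate, S; split; [|exact: cE|exact: dE].
apply: filterS nE => t' nE t'01; have [ct' PE rateE SE] := nE t'01.
exact: (And3 (etrans (pairing_chart_indep he hH hg t'01 (ccP t') ct') PE) rateE SE).
Qed.
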